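(* Let $k,n\geq 1$, let $f_1,\ldots,f_k:\{0,1\}^n\to\mathbb{R}_{\geq 0}$ and $g:\{0,1\}^{kn}\to\mathbb{R}_{\geq 0}$ be nonnegative functions such that $g$ is log-supermodular (viewing $g$ as a function of $(x^1,\ldots,x^k)$ with each $x^i\in\{0,1\}^n$). If for all $x^1,\ldots,x^k\in\{0,1\}^n$, \[g(x^1,\ldots,x^k)\leq \prod_{i=1}^k f_i\big(z^i(x^1,\ldots,x^k)\big),\] then \[\sum_{x^1,\ldots,x^k\in\{0,1\}^n} g(x^1,\ldots,x^k)\leq \prod_{i=1}^k\Big[\sum_{x\in\{0,1\}^n} f_i(x)\Big].\]
   Context: A function $g:\{0,1\}^m\to\mathbb{R}_{\geq 0}$ is log-supermodular if $g(x)g(y)\leq g(x\wedge y)g(x\vee y)$ for all $x,y\in\{0,1\}^m$, where $(x\wedge y)_j=\min\{x_j,y_j\}$ and $(x\vee y)_j=\max\{x_j,y_j\}$. For vectors $x^1,\ldots,x^k\in\{0,1\}^n$, $z^i(x^1,\ldots,x^k)\in\{0,1\}^n$ is the vector whose $j$-th component is the $i$-th largest element (with multiplicity) of $x^1_j,\ldots,x^k_j$, i.e. equals $1$ if $\sum_{a=1}^k x^a_j\geq i$ and $0$ otherwise. *)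

(* Defs.v *)
From mathcomp Require Import all_boot all_order all_algebra reals.
Set Implicit Arguments.
Unset Strict Implicit.
Unset Printing Implicit Defensive.
Import Order.TTheory GRing.Theory Num.Theory.
Local Open Scope ring_scope.

(* The cube {0,1}^I for a finite index set I; {0,1}^n is cube 'I_n, and
   {0,1}^{kn} is taken as cube ('I_k * 'I_n)%type, so that the coordinate (a, j)
   is the j-th component of the a-th block. The bit 1 is true. *)
Definition cube (I : finType) := {ffun I -> bool}.

(* On bits, && is the minimum and || the maximum. *)
Definition cube_meet (I : finType) (x y : cube I) : cube I :=
  [ffun j => x j && y j].

Definition cube_join (I : finType) (x y : cube I) : cube I :=
  [ffun j => x j || y j].

Definition log_supermodular (R : realType) (I : finType) (g : cube I -> R) :=
  forall x y : cube I, g x * g y <= g (cube_meet x y) * g (cube_join x y).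

(* The point of {0,1}^{kn} with blocks x^1, ..., x^k. *)
Definition cube_blocks (k n : nat) (x : {ffun 'I_k -> cube 'I_n}) :
    cube ('I_k * 'I_n)%type :=
  [ffun p => x p.1 p.2].

(* Indices in 'I_k start at 0, so zvec x i is the vector of the (i+1)-th largest
   entries, whose j-th component is 1 iff at least i+1 of the x^a_j are 1. *)
Definition zvec (k n : nat) (x : {ffun 'I_k -> cube 'I_n}) (i : 'I_k) :
    cube 'I_n :=
  [ffun j => (i.+1 <= \sum_(a < k) nat_of_bool (x a j))%N].

(* Main.v *)
(* Summing [g] over a column of bits (one bit of every block) preserves
   log-supermodularity, and turns each [f i] into its marginal over one bit, so
   the columns can be summed one at a time and the case [n = 1] suffices. There,
   for any distinct [T_1, ..., T_l] in {0,1}^k, iterating log-supermodularity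
   gives [\prod_j g T_j <= \prod_i g Z_i], with [Z_i] the set of elements lying
   in more than [i] of the [T_j]; by hypothesis this is at most
   [\prod_j w (T_j o s)], where [w] is the product of the [f i] and [s] is a
   permutation of the k blocks sorting the degrees. Hence [g] is weakly
   log-majorized by [w], so its sum is at most that of [w]. *)

Require Import Defs.
From mathcomp Require Import all_boot all_order all_algebra reals.
From mathcomp Require Import perm lra zify.
Import Order.TTheory GRing.Theory Num.Theory.
Local Open Scope ring_scope.
Set Implicit Arguments.
Unset Strict Implicit.
Unset Printing Implicit Defensive.

(** * Induction on finite sets and sorted enumerations *)

Lemma set_ind (T : finType) (P : {set T} -> Prop) :
  P set0 -> (forall x (D : {set T}), x \notin D -> P D -> P (x |: D)) -> forall D, P D.
Proof.
move=> P0 PS D; move: {2}#|D| (erefl #|D|) => m.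
elim: m D => [|m IH] D; first by move/cards0_eq->.
move=> cD; have /card_gt0P[x xD] : (0 < #|D|)%N by rewrite cD.
rewrite -(setD1K xD); apply: PS; first by rewrite !inE eqxx.
by apply: IH; move: cD; rewrite (cardsD1 x) xD => -[].
Qed.

Lemma exists_sorted_enum (T : finType) (disp : Order.disp_t)
    (V : orderType disp) (f : T -> V) :
  exists e : seq T, perm_eq e (enum T) /\
    forall x0 i j, (i <= j < size e)%N ->
      (f (nth x0 e j) <= f (nth x0 e i))%O.
Proof.
pose r := [rel x y : T | (f y <= f x)%O].
exists (sort r (enum T)); split; first by rewrite perm_sort.
move=> x0 i j /andP[ij js].
have rtr : transitive r by move=> y x z /= xy yz; exact: le_trans yz xy.
have rrefl : reflexive r by move=> x /=.
have srt : sorted r (sort r (enum T)).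
  by apply: sort_sorted => x y /=; exact: le_total.
by apply: (sorted_leq_nth rtr rrefl x0 srt) => //; rewrite inE ?(leq_ltn_trans ij).
Qed.

(** * Sum inequalities from log-majorization *)

Section Majorization.
Variable R : realFieldType.

(* Weak log-majorization implies weak majorization. With ratios [t i = b i / a i],
   AM-GM turns [1 <= \prod_(i < l) t i] into [l <= \sum_(i < l) t i], and Abel
   summation against the nonincreasing weights [a] concludes. *)
Lemma ler_sum_log_majorization (N : nat) (a b : nat -> R) :
  (forall i, 0 <= a i) -> (forall i, 0 <= b i) ->
  (forall i j, (i <= j < N)%N -> a j <= a i) ->
  (forall l, (l <= N)%N -> \prod_(i < l) a i <= \prod_(i < l) b i) ->
  \sum_(i < N) a i <= \sum_(i < N) b i.
Proof.
move=> a0 b0; elim: N => [|N IH] adecr hab; first by rewrite !big_ord0.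
(* If the smallest weight vanishes, the last term is harmless and the shorter sums suffice;
   otherwise every [a i] is positive and the ratios make sense. *)
have [aN0|aNpos] := leP (a N) 0.
  rewrite !big_ord_recr /=.
  apply: lerD; last exact: le_trans aN0 (b0 N).
  apply: IH => [i j /andP[ij jN]|l lN]; last by apply: hab; exact: leqW.
  by apply: adecr; rewrite ij ltnW.
have apos i : (i <= N)%N -> 0 < a i.
  by move=> iN; apply: lt_le_trans aNpos _; apply: adecr; rewrite iN /=.
pose t i := b i / a i.
have t0 i : 0 <= t i by rewrite divr_ge0.
have prodt l : (l <= N.+1)%N -> 1 <= \prod_(i < l) t i.
  move=> lN; rewrite /t big_split /= prodfV ler_pdivlMr ?mul1r ?hab //.
  by apply: prodr_gt0 => i _; apply: apos; have := ltn_ord i; lia.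
have sumt l : (l <= N.+1)%N -> 0 <= \sum_(i < l) (t i - 1).
  case: l => [|l] lN; first by rewrite big_ord0.
  rewrite big_split /= sumrN sumr_const card_ord subr_ge0.
  have [agm _] := leif_AGM (A := [pred _ : 'I_l.+1 | true])
    (E := fun i : 'I_l.+1 => t i) (fun i _ => t0 i).
  rewrite cardE /= -cardE card_ord in agm.
  have := le_trans (prodt _ lN) agm.
  rewrite expr_ge1 ?ler_pdivlMr ?ltr0Sn ?mul1r //.
  by rewrite mul0r sumr_ge0.
have abel l : (l <= N)%N ->
    a l * \sum_(i < l.+1) (t i - 1) <= \sum_(i < l.+1) a i * (t i - 1).
  elim: l => [|l IHl] lN; first by rewrite !big_ord_recr !big_ord0 /= !add0r.
  rewrite big_ord_recr [leRHS]big_ord_recr /= mulrDr lerD2r.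
  apply: le_trans (IHl (ltnW lN)); apply: ler_wpM2r; first by apply: sumt; lia.
  by apply: adecr; lia.
rewrite -subr_ge0 -sumrB.
rewrite (eq_bigr (fun i : 'I_N.+1 => a i * (t i - 1))); last first.
  move=> i _; rewrite mulrBr mulr1 /t mulrC divfK // gt_eqF // apos //.
  by rewrite -ltnS.
by apply: le_trans (abel _ (leqnn N)); rewrite mulr_ge0 ?a0 ?sumt.
Qed.

(** An exchange argument: with [C] the first [#|B|] entries of [e], the sets [B :\: C] and [C :\: B]
    have equal size, and a pivot value separates the factors over the first from those over the
    second. *)
Lemma prod_le_prod_top (T : finType) (b : T -> R) (b0 : forall x, 0 <= b x)
    (e : seq T) (x0 : T) (B : {set T}) :
  perm_eq e (enum T) ->
  (forall i j, (i <= j < size e)%N -> b (nth x0 e j) <= b (nth x0 e i)) ->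
  \prod_(x in B) b x <= \prod_(i < #|B|) b (nth x0 e i).
Proof.
move=> pe be; set l := #|B|.
have ue : uniq e by rewrite (perm_uniq pe) enum_uniq.
have se : size e = #|T| by rewrite (perm_size pe) -cardE.
have mem_e x : x \in e by rewrite (perm_mem pe) mem_enum.
have lT : (l <= size e)%N by rewrite se max_card.
pose C := [set x in take l e].
have cC : #|C| = l.
  by rewrite cardsE; move/card_uniqP: (take_uniq l ue) => ->; rewrite size_takel.
have -> : \prod_(i < l) b (nth x0 e i) = \prod_(x in C) b x.
  rewrite /C; under [RHS]eq_bigl do rewrite inE.
  rewrite -big_uniq ?take_uniq //= (big_nth x0) size_takel // big_mkord.
  by apply: eq_bigr => i _; rewrite nth_take.
rewrite (big_setID C) [leRHS](big_setID B) /= (setIC C).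
apply: ler_wpM2l; first by apply: prodr_ge0.
have cD : #|B :\: C| = #|C :\: B|.
  by have := cardsID C B; have := cardsID B C; rewrite cC (setIC C) -/l; lia.
(* The pivot is the first value after [C]. When [l = size e] it is the default [b x0], which is
   harmless: both differences are then empty. *)
pose m := b (nth x0 e l).
have m0 : 0 <= m by exact: b0.
apply: (@le_trans _ _ (m ^+ #|C :\: B|)).
  rewrite -cD -prodr_const; apply: ler_prod => x; rewrite !inE => /andP[xC _].
  rewrite b0 /= -(nth_index x0 (mem_e x)); apply: be.
  by rewrite index_mem mem_e andbT leqNgt -in_take_leq.
rewrite -prodr_const; apply: ler_prod => x; rewrite !inE => /andP[xB xC].
have ll : (l < size e)%N.
  by rewrite se ltn_neqAle max_card andbT; apply: contraNneq xB => lE; rewrite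
    (subset_cardP _ (subset_predT B)).
rewrite m0 /= -[in leRHS](nth_index x0 (mem_e x)); apply: be.
by rewrite ll andbT ltnW // -in_take_leq.
Qed.

(** Sort both functions and take for [A] the [l] largest values of [a]: the product over [B] is at
    most that of the [l] largest values of [b]. Thus [B] may vary freely with [A]. *)
Lemma ler_sum_set_log_majorization (T : finType) (a b : T -> R) :
  (forall x, 0 <= a x) -> (forall x, 0 <= b x) ->
  (forall A : {set T}, exists2 B : {set T},
     #|B| = #|A| & \prod_(x in A) a x <= \prod_(x in B) b x) ->
  \sum_x a x <= \sum_x b x.
Proof.
move=> a0 b0 hab.
case: (pickP T) => [x0 _|T0]; last by rewrite !big_pred0.
have [ea [pa sa]] := exists_sorted_enum a.
have [eb [pb sb]] := exists_sorted_enum b.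
have sumE (c : T -> R) e : perm_eq e (enum T) ->
    \sum_x c x = \sum_(i < #|T|) c (nth x0 e i).
  move=> pe; rewrite -big_enum /= -(perm_big _ pe) /= (big_nth x0).
  by rewrite (perm_size pe) -cardE big_mkord.
have sza : size ea = #|T| by rewrite (perm_size pa) -cardE.
rewrite (sumE a _ pa) (sumE b _ pb).
apply: (@ler_sum_log_majorization _ (fun i => a (nth x0 ea i))
  (fun i => b (nth x0 eb i))) => // [i j ijT|l lT].
  by apply: sa; rewrite sza.
have ul : uniq (take l ea) by rewrite take_uniq // (perm_uniq pa) enum_uniq.
have [B cB hB] := hab [set x in take l ea].
have cl : #|B| = l.
  by rewrite cB cardsE; move/card_uniqP: ul => ->; rewrite size_takel // sza.
apply: le_trans (le_trans hB _); last first.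
  by have := prod_le_prod_top b0 B pb (sb x0); rewrite cl.
under [leRHS]eq_bigl do rewrite inE.
rewrite -big_uniq //= (big_nth x0) size_takel ?sza // big_mkord.
by under [leRHS]eq_bigr do rewrite nth_take //.
Qed.

End Majorization.

(** * The inequality for a single column of bits *)

Section OneColumn.
Variable R : realType.

Definition threshold (I : finType) (s : seq (cube I)) (i : nat) : cube I :=
  [ffun a => (i < count (fun x : cube I => x a) s)%N].

(* Inserting [y] into the chain of thresholds of [s] by successively trading
   [y /\ Z_{m-1}] and [Z_m] for their meet and join. *)
Lemma prod_le_prod_threshold (I : finType) (h : cube I -> R)
    (h0 : forall x, 0 <= h x) (hL : log_supermodular h) (s : seq (cube I)) :
  \prod_(x <- s) h x <= \prod_(i < size s) h (threshold s i).
Proof.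
elim: s => [|y s IH]; first by rewrite big_nil big_ord0.
(* [W m] is what is left of [y] after [m] trades: [W 0] is [y], and [W (size s)] is the last
   threshold of [y :: s]. *)
pose W m : cube I := [ffun a => y a && (m <= count (fun x : cube I => x a) s)%N].
have ins m : h y * \prod_(i < m) h (threshold s i) <=
    \prod_(i < m) h (threshold (y :: s) i) * h (W m).
  elim: m => [|m IHm].
    rewrite !big_ord0 mulr1 mul1r le_eqVlt; apply/orP; left; apply/eqP.
    by congr h; apply/ffunP => a; rewrite ffunE andbT.
  rewrite !big_ord_recr /= mulrA.
  apply: le_trans (ler_wpM2r (h0 _) IHm) _.
  rewrite -!mulrA; apply: ler_wpM2l; first exact: prodr_ge0.
  apply: le_trans (hL _ _) _; rewrite mulrC le_eqVlt; apply/orP; left.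
  apply/eqP; congr (h _ * h _); apply/ffunP => a; rewrite !ffunE /=;
    by case: (y a) => /=; lia.
rewrite big_cons /= big_ord_recr /=.
apply: le_trans (ler_wpM2l (h0 y) IH) (le_trans (ins _) _).
rewrite le_eqVlt; apply/orP; left; apply/eqP; congr (_ * h _).
apply/ffunP => a; rewrite !ffunE /=.
by have := count_size (fun x : cube I => x a) s; case: (y a) => /=; lia.
Qed.

Lemma prod_bool (T : Type) (s : seq T) (p : pred T) (c : bool -> R) :
  \prod_(x <- s) c (p x) =
  c true ^+ count p s * c false ^+ (size s - count p s).
Proof.
elim: s => [|x s IH]; first by rewrite big_nil mul1r.
rewrite big_cons IH /=; have := count_size p s.
case: (p x) => /= cs; first by rewrite add1n subSS exprS mulrA.
by rewrite add0n subSn // exprS mulrCA.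
Qed.

Lemma prod_threshold (l d : nat) (c : bool -> R) : (d <= l)%N ->
  \prod_(i < l) c (i < d)%N = c true ^+ d * c false ^+ (l - d).
Proof.
move=> dl; rewrite -(big_mkord predT (fun i => c (i < d)%N)).
rewrite (big_cat_nat (n := d)) //=; congr (_ * _).
  rewrite (eq_big_nat _ _ (F2 := fun=> c true)) ?prodr_const_nat ?subn0 // => i.
  by move=> /= ->.
rewrite (eq_big_nat _ _ (F2 := fun=> c false)) ?prodr_const_nat // => i.
by move=> /andP[]; rewrite leqNgt => /negbTE ->.
Qed.

Lemma exists_sorting_perm (k : nat) (d : 'I_k -> nat) :
  exists s : 'S_k, forall i j : 'I_k, (i <= j)%N -> (d (s j) <= d (s i))%N.
Proof.
have [e [pe se]] := exists_sorted_enum d.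
have sz : size e = k by rewrite (perm_size pe) -cardE card_ord.
have ue : uniq e by rewrite (perm_uniq pe) enum_uniq.
have inj : injective (fun i : 'I_k => nth i e i).
  move=> i j; rewrite (set_nth_default j) ?sz // => /eqP.
  by rewrite nth_uniq ?sz // => /eqP/val_inj.
exists (perm inj) => i j ij; rewrite !permE (set_nth_default j) ?sz //.
by apply: se; rewrite ij sz /=.
Qed.

(** Once the degrees are sorted, the [a] with [i < d (s a)] form an initial segment of ['I_k], whose
    size exceeds [j] exactly when it contains [j]. *)
Lemma ltn_card_sorted (k : nat) (d : 'I_k -> nat) (s : 'S_k) (i : nat) (j : 'I_k) :
  (forall i j : 'I_k, (i <= j)%N -> (d (s j) <= d (s i))%N) ->
  (j < \sum_(a < k) (i < d a))%N = (i < d (s j))%N.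
Proof.
move=> hs; have -> : (\sum_(a < k) (i < d a) = #|[pred a | i < d (s a)]|)%N.
  rewrite (reindex_inj (@perm_inj _ s)) -sum1_card [RHS]big_mkcond /=.
  by apply: eq_bigr => a _; rewrite inE; case: ltnP.
have cle (m : nat) : (m <= k)%N -> #|[pred a : 'I_k | (a < m)%N]| = m.
  move=> mk; rewrite -sum1_card (big_ord_narrow mk) /=.
  by rewrite sum1_card card_ord.
case: (ltnP i (d (s j))) => ij.
  rewrite -[X in (X <= _)%N](cle j.+1) //. 
  apply: subset_leq_card; apply/subsetP => a.
  by rewrite !inE ltnS => /hs/(leq_trans ij).
apply/negbTE; rewrite -leqNgt.
apply: (@leq_trans #|[pred a : 'I_k | (a < j)%N]|); last by rewrite cle // ltnW.
apply: subset_leq_card; apply/subsetP => a; rewrite !inE; apply: contraTT.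
by rewrite -!leqNgt => /hs/leq_trans; apply.
Qed.

Lemma one_column (k : nat) (h : cube 'I_k -> R) (c : 'I_k -> bool -> R)
    (h0 : forall x, 0 <= h x) (hL : log_supermodular h)
    (c0 : forall i b, 0 <= c i b) :
  (forall w : cube 'I_k, h w <= \prod_(i < k) c i (i < \sum_(a < k) w a)%N) ->
  \sum_w h w <= \prod_(i < k) (c i false + c i true).
Proof.
move=> hc.
(* Expanding the product turns the right-hand side into the total mass of a product weight on the
   cube. *)
have -> : \prod_(i < k) (c i false + c i true) =
    \sum_(w : cube 'I_k) \prod_(i < k) c i (w i).
  rewrite -(bigA_distr_bigA c) /=; apply: eq_bigr => i _.
  by rewrite big_bool addrC.
apply: ler_sum_set_log_majorization => // [w|A]; first exact: prodr_ge0.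
pose deg (a : 'I_k) := count (fun x : cube 'I_k => x a) (enum A).
have [s hs] := exists_sorting_perm deg.
pose rho (x : cube 'I_k) : cube 'I_k := [ffun j => x (s j)].
have rho_inj : injective rho.
  move=> x y /ffunP xy; apply/ffunP => a.
  by have := xy ((s^-1)%g a); rewrite !ffunE permKV.
exists (rho @: A); first by rewrite card_imset.
rewrite big_imset /=; last by move=> ? ? _ _; exact: rho_inj.
rewrite -big_enum -[leRHS]big_enum /=.
apply: le_trans (prod_le_prod_threshold h0 hL _) _.
apply: (@le_trans _ _ (\prod_(i < size (enum A)) \prod_(j < k)
    c j (j < \sum_(a < k) threshold (enum A) i a)%N)).
  by apply: ler_prod => i _; rewrite h0; exact: hc.
(* For each fixed [j] the two sides agree: the factor [c j true] occurs [deg (s j)] times among the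
   thresholds and equally often over [rho @: A]. *)
rewrite exchange_big [leRHS]exchange_big /=; apply: ler_prod => j _.
rewrite !prodr_ge0 //=.
under [leRHS]eq_bigr do rewrite ffunE.
rewrite (prod_bool _ (fun x : cube 'I_k => x (s j))).
rewrite -(prod_threshold _ (count_size _ _)) le_eqVlt; apply/orP; left.
apply/eqP/eq_bigr => i _; congr (c j).
under eq_bigr do rewrite ffunE.
exact: (ltn_card_sorted _ _ hs).
Qed.

End OneColumn.

(** * Marginals and their log-supermodularity *)

Section Marginals.
Variable R : realType.

Definition agree (I : finType) (D : {set I}) (x y : cube I) :=
  [forall q, (q \notin D) ==> (x q == y q)].

Lemma agreeP (I : finType) (D : {set I}) (x y : cube I) :
  reflect (forall q, q \notin D -> x q = y q) (agree D x y).
Proof.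
apply: (iffP forallP) => [h q qD|h q]; first by apply/eqP; exact: implyP (h q) qD.
by apply/implyP => /h ->.
Qed.

(* The marginal stays a function on the whole cube: it ignores the coordinates
   in [D], over which [g] is summed. *)
Definition marg (I : finType) (D : {set I}) (g : cube I -> R) (x : cube I) : R :=
  \sum_(u : cube I | agree D u x) g u.

Lemma marg_ge0 (I : finType) (D : {set I}) (g : cube I -> R) :
  (forall x, 0 <= g x) -> forall x, 0 <= marg D g x.
Proof. by move=> g0 x; exact: sumr_ge0. Qed.

Lemma marg0 (I : finType) (g : cube I -> R) x : marg set0 g x = g x.
Proof.
apply: big_pred1 => u; apply/agreeP/eqP => [h|-> //].
by apply/ffunP => q; rewrite h ?inE.
Qed.

Lemma margT (I : finType) (g : cube I -> R) x : marg [set: I] g x = \sum_u g u.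
Proof. by apply: eq_bigl => u; apply/agreeP => q; rewrite inE. Qed.

Lemma marg_setU (I : finType) (D E : {set I}) (g : cube I -> R) x :
  [disjoint D & E] -> marg (D :|: E) g x = marg D (marg E g) x.
Proof.
move=> dDE.
(* [mix v] is the point of the outer sum to which [v] contributes; as [D] and [E] are disjoint, [v]
   differs from it only on [E]. *)
pose mix (v : cube I) : cube I := [ffun q => if q \in D then v q else x q].
rewrite {1}/marg (partition_big mix (fun u => agree D u x)); last first.
  by move=> v _; apply/agreeP => q /negbTE qD; rewrite ffunE qD.
apply: eq_bigr => u /agreeP ux; apply: eq_bigl => v.
apply/andP/agreeP => [[/agreeP vx /eqP <-] q qE|vu].
  by rewrite ffunE; case: ifPn => // qD; rewrite vx // inE negb_or qD.
split; first by apply/agreeP => q; rewrite inE negb_or => /andP[/ux <- /vu].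
apply/eqP/ffunP => q; rewrite ffunE; case: ifPn => [qD|/ux //].
by rewrite vu // (disjointFr dDE qD).
Qed.

Definition upd (I : finType) (x : cube I) (p : I) (b : bool) : cube I :=
  [ffun q => if q == p then b else x q].

Lemma marg_set1 (I : finType) (p : I) (g : cube I -> R) x :
  marg [set p] g x = g (upd x p false) + g (upd x p true).
Proof.
have one b : \sum_(u : cube I | agree [set p] u x && (u p == b)) g u = g (upd x p b).
  apply: big_pred1 => u; apply/andP/eqP => [[/agreeP ux /eqP <-]|->].
    by apply/ffunP => q; rewrite ffunE; case: eqP => [->//|/eqP qp]; rewrite ux ?inE.
  split; last by rewrite ffunE eqxx.
  by apply/agreeP => q; rewrite inE ffunE => /negbTE ->.
rewrite /marg (bigID (fun u : cube I => u p == false)) /= one; congr (_ + _).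
by rewrite -one; apply: eq_bigl => u; case: (u p).
Qed.

Lemma cube_meet_upd (I : finType) (x y : cube I) p b c :
  cube_meet (upd x p b) (upd y p c) = upd (cube_meet x y) p (b && c).
Proof. by apply/ffunP => q; rewrite !ffunE; case: eqP. Qed.

Lemma cube_join_upd (I : finType) (x y : cube I) p b c :
  cube_join (upd x p b) (upd y p c) = upd (cube_join x y) p (b || c).
Proof. by apply/ffunP => q; rewrite !ffunE; case: eqP. Qed.

(** Expanding [(C - P) * (C - Q) >= 0] gives [C * (P + Q) <= C * C + P * Q <= C * (C + D)]; if
    [C = 0], then [P] and [Q] vanish too. *)
Lemma ler_add_mul_le (P Q C D : R) : 0 <= P -> 0 <= Q -> 0 <= C -> 0 <= D ->
  P <= C -> Q <= C -> P * Q <= C * D -> P + Q <= C + D.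
Proof.
move=> P0 Q0 C0 D0 PC QC PQ.
have [Cp|Cn] := ltP 0 C; last by lra.
rewrite -(ler_pM2l Cp); have := mulr_ge0 (_ : 0 <= C - P) (_ : 0 <= C - Q).
rewrite !subr_ge0 => /(_ PC QC); lra.
Qed.

(** The four functions theorem on one bit. The extreme products are bounded directly; both mixed
    products are at most [m0 * j1], and multiplying the two extreme bounds controls their product,
    so [ler_add_mul_le] bounds their sum. *)
Lemma ler_mul_addr2 (a0 a1 b0 b1 m0 m1 j0 j1 : R) :
  0 <= a0 -> 0 <= a1 -> 0 <= b0 -> 0 <= b1 ->
  0 <= m0 -> 0 <= m1 -> 0 <= j0 -> 0 <= j1 ->
  a0 * b0 <= m0 * j0 -> a0 * b1 <= m0 * j1 ->
  a1 * b0 <= m0 * j1 -> a1 * b1 <= m1 * j1 ->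
  (a0 + a1) * (b0 + b1) <= (m0 + m1) * (j0 + j1).
Proof.
move=> A0 A1 B0 B1 M0 M1 J0 J1 h00 h01 h10 h11.
have hX : a0 * b1 * (a1 * b0) <= m0 * j1 * (m1 * j0).
  by have := ler_pM (mulr_ge0 A0 B0) (mulr_ge0 A1 B1) h00 h11; lra.
have := ler_add_mul_le (mulr_ge0 A0 B1) (mulr_ge0 A1 B0) (mulr_ge0 M0 J1)
  (mulr_ge0 M1 J0) h01 h10 hX.
lra.
Qed.

Lemma log_supermodular_marg1 (I : finType) (p : I) (g : cube I -> R) :
  (forall x, 0 <= g x) -> log_supermodular g -> log_supermodular (marg [set p] g).
Proof.
move=> g0 gL x y; rewrite !marg_set1.
have h b c : g (upd x p b) * g (upd y p c) <=
    g (upd (cube_meet x y) p (b && c)) * g (upd (cube_join x y) p (b || c)).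
  by rewrite -cube_meet_upd -cube_join_upd.
by apply: ler_mul_addr2 (h false false) (h false true) (h true false)
  (h true true).
Qed.

Lemma log_supermodular_marg (I : finType) (D : {set I}) (g : cube I -> R) :
  (forall x, 0 <= g x) -> log_supermodular g -> log_supermodular (marg D g).
Proof.
move=> g0 gL; elim/set_ind: D => [|p D pD IH] x y; first by rewrite !marg0.
rewrite !marg_setU ?disjoints1 //.
by apply: log_supermodular_marg1 => //; exact: marg_ge0.
Qed.

End Marginals.

(** * Summing out the columns one at a time *)

Section Columns.
Variables (R : realType) (k n : nat).
Implicit Types (y : cube ('I_k * 'I_n)%type) (D : {set 'I_n}).

Definition blocks y : {ffun 'I_k -> cube 'I_n} := [ffun a => [ffun j => y (a, j)]].

Lemma blocksK y : cube_blocks (blocks y) = y.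
Proof. by apply/ffunP => -[a j]; rewrite !ffunE. Qed.

Lemma cube_blocksK (x : {ffun 'I_k -> cube 'I_n}) : blocks (cube_blocks x) = x.
Proof. by apply/ffunP => a; apply/ffunP => j; rewrite !ffunE. Qed.

Definition cols D : {set 'I_k * 'I_n} := [set p | p.2 \in D].

Definition set_col y (j : 'I_n) (w : cube 'I_k) : cube ('I_k * 'I_n)%type :=
  [ffun p => if p.2 == j then w p.1 else y p].

Lemma marg_col (g : cube ('I_k * 'I_n)%type -> R) j y :
  marg (cols [set j]) g y = \sum_w g (set_col y j w).
Proof.
rewrite /marg (reindex_onto (set_col y j)
  (fun u : cube ('I_k * 'I_n)%type => [ffun a => u (a, j)] : cube 'I_k)); last first.
  move=> u /agreeP uy; apply/ffunP => -[a i]; rewrite !ffunE /=.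
  by case: eqP => [->//|/eqP ij]; rewrite uy // !inE.
apply: eq_bigl => w; apply/andP; split.
  by apply/agreeP => -[a i]; rewrite !inE ffunE /= => /negbTE ->.
by apply/eqP/ffunP => a; rewrite !ffunE eqxx.
Qed.

Lemma zvec_set_col y j w i :
  zvec (blocks (set_col y j w)) i =
  upd (zvec (blocks y) i) j (i < \sum_(a < k) w a)%N.
Proof.
apply/ffunP => q; rewrite !ffunE; case: eqP => [->|/eqP qj].
  by under eq_bigr do rewrite !ffunE eqxx.
by under eq_bigr do rewrite !ffunE (negbTE qj);
   under [in RHS]eq_bigr do rewrite !ffunE.
Qed.

Lemma marg_col_le (f : 'I_k -> cube 'I_n -> R) (g : cube ('I_k * 'I_n)%type -> R)
    (j : 'I_n) :
  (forall i x, 0 <= f i x) -> (forall x, 0 <= g x) -> log_supermodular g ->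
  (forall y, g y <= \prod_(i < k) f i (zvec (blocks y) i)) ->
  forall y, marg (cols [set j]) g y <=
    \prod_(i < k) marg [set j] (f i) (zvec (blocks y) i).
Proof.
move=> f0 g0 gL hgf y; rewrite marg_col.
under [leRHS]eq_bigr do rewrite marg_set1.
(* All columns but [j] are frozen. Column [j] then affects only bit [j] of each sorted vector, and
   only through its number of ones. *)
apply: (one_column (h := fun w => g (set_col y j w))
  (c := fun i b => f i (upd (zvec (blocks y) i) j b))) => //.
  move=> w w' /=; apply: le_trans (gL _ _) _; rewrite le_eqVlt; apply/orP; left.
  by apply/eqP; congr (g _ * g _); apply/ffunP => p; rewrite !ffunE; case: eqP;
     rewrite ?andbb ?orbb.
by move=> w; apply: le_trans (hgf _) _; under eq_bigr do rewrite zvec_set_col.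
Qed.

Lemma marg_cols_le (f : 'I_k -> cube 'I_n -> R) (g : cube ('I_k * 'I_n)%type -> R)
    (D : {set 'I_n}) :
  (forall i x, 0 <= f i x) -> (forall x, 0 <= g x) -> log_supermodular g ->
  (forall y, g y <= \prod_(i < k) f i (zvec (blocks y) i)) ->
  forall y, marg (cols D) g y <=
    \prod_(i < k) marg D (f i) (zvec (blocks y) i).
Proof.
move=> f0 g0 gL hgf; elim/set_ind: D => [|j D jD IH] y.
  have -> : cols set0 = set0 by apply/setP => p; rewrite !inE.
  by rewrite marg0; under eq_bigr do rewrite marg0.
have -> : cols (j |: D) = cols [set j] :|: cols D.
  by apply/setP => p; rewrite !inE.
rewrite marg_setU; last first.
  rewrite disjoint_subset; apply/subsetP => p; rewrite !inE => /eqP -> //.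
under [leRHS]eq_bigr do rewrite marg_setU ?disjoints1 //.
(* The marginals over [D] replace [f] and [g]: the induction hypothesis is their pointwise bound,
   and log-supermodularity survives summation. *)
apply: marg_col_le => //; first by move=> i; exact: marg_ge0.
  exact: marg_ge0.
exact: log_supermodular_marg.
Qed.

End Columns.

Theorem theorem5 (R : realType) (k n : nat) (hk : (1 <= k)%N) (hn : (1 <= n)%N)
    (f : 'I_k -> cube 'I_n -> R) (g : cube ('I_k * 'I_n)%type -> R)
    (f_ge0 : forall (i : 'I_k) (x : cube 'I_n), 0 <= f i x)
    (g_ge0 : forall x : cube ('I_k * 'I_n)%type, 0 <= g x)
    (g_lsm : log_supermodular g)
    (hgf : forall x : {ffun 'I_k -> cube 'I_n},
       g (cube_blocks x) <= \prod_(i < k) f i (zvec x i)) :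
  \sum_(x : {ffun 'I_k -> cube 'I_n}) g (cube_blocks x)
    <= \prod_(i < k) (\sum_(x : cube 'I_n) f i x).
Proof.
rewrite -(reindex (P := predT) (F := g) (@cube_blocks k n)) /=; last first.
  by apply: onW_bij; exists (@blocks k n); [exact: cube_blocksK|exact: blocksK].
(* Any base point would do: marginals over all coordinates are constant. *)
pose y0 : cube ('I_k * 'I_n)%type := [ffun=> false].
have hgf' y : g y <= \prod_(i < k) f i (zvec (blocks y) i).
  by rewrite -{1}(blocksK y).
have := marg_cols_le [set: 'I_n] f_ge0 g_ge0 g_lsm hgf' y0.
have -> : cols k [set: 'I_n] = [set: 'I_k * 'I_n].
  by apply/setP => p; rewrite !inE.
by rewrite margT; under [X in _ <= X -> _]eq_bigr do rewrite margT.
Qed.
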